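(* Let $n\ge 2$. (i) If $T:\mathcal{S}(\mathbb{R}^n)\to\mathcal{S}(\mathbb{R}^n)$ is equimeasurable, then $\operatorname{ess\,inf} Tf=\operatorname{ess\,inf} f$ for all $f\in\mathcal{S}(\mathbb{R}^n)$. (ii) If $T:\mathcal{M}(\mathbb{R}^n)\to\mathcal{M}(\mathbb{R}^n)$ is a rearrangement, then $\operatorname{ess\,inf} Tf\ge\operatorname{ess\,inf} f$ for all $f\in\mathcal{M}(\mathbb{R}^n)$. Hence, $T$ maps $\mathcal{S}(\mathbb{R}^n)$ into $\mathcal{S}(\mathbb{R}^n)$. (iii) In either case (i.e., if $T$ satisfies the hypothesis of (i) or the hypothesis of (ii)), $T$ maps $\mathcal{V}(\mathbb{R}^n)$ into $\mathcal{V}(\mathbb{R}^n)$, and $T$ is essentially the identity on constant functions, i.e., if $f\equiv c$ with $c\in\mathbb{R}$, then $Tf=c$ essentially.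
   Context: $\mathcal{H}^n$ is $n$-dimensional Hausdorff (Lebesgue) measure on $\mathbb{R}^n$; ''essentially'' means up to a set of $\mathcal{H}^n$-measure zero. $\mathcal{M}(\mathbb{R}^n)$ is the set of real-valued $\mathcal{H}^n$-measurable functions on $\mathbb{R}^n$. $\mathcal{S}(\mathbb{R}^n)$ is the set of $f\in\mathcal{M}(\mathbb{R}^n)$ with $\mathcal{H}^n(\{x:f(x)>t\})<\infty$ for all real $t>\operatorname{ess\,inf} f$ (where $\operatorname{ess\,inf} f=-\infty$ is allowed). $\mathcal{V}(\mathbb{R}^n)$ is the set of nonnegative $f\in\mathcal{M}(\mathbb{R}^n)$ with $\mathcal{H}^n(\{x:f(x)>t\})<\infty$ for all $t>0$. For $X\subset\mathcal{M}(\mathbb{R}^n)$, a map $T:X\to X$ is equimeasurable if $\mathcal{H}^n(\{x:Tf(x)>t\})=\mathcal{H}^n(\{x:f(x)>t\})$ for all $f\in X$ and $t\in\mathbb{R}$; it is monotonic if for $f,g\in X$, $f\le g$ essentially implies $Tf\le Tg$ essentially; it is a rearrangement if it is equimeasurable and monotonic.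
   Formalization: In V(R^n), ''nonnegative'' is read as essentially nonnegative (f ≥ 0 almost everywhere); with pointwise nonnegativity, ''T maps V into V'' fails for a T that changes each f to −1 at a single point. *)

(* Defs.v *)
From HB Require Import structures.
From mathcomp Require Import all_boot all_order all_algebra.
From mathcomp Require Import all_classical all_reals all_analysis.
From mathcomp Require Import ess_sup_inf.

Set Implicit Arguments.
Unset Strict Implicit.
Unset Printing Implicit Defensive.

Import Order.TTheory GRing.Theory Num.Theory.
Import numFieldNormedType.Exports.

Local Open Scope classical_set_scope.
Local Open Scope ring_scope.

Section lebesgue_outer_measure.
Context {R : realType} {n : nat}.
Implicit Types (p : 'rV[R]_n * 'rV[R]_n) (A : set 'rV[R]_n).

Definition box p : set 'rV[R]_n :=
  [set x | forall i, x 0 i \in `]p.1 0 i, p.2 0 i]].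

Definition box_volume p : R := \prod_(i < n) Num.max 0 (p.2 0 i - p.1 0 i).

Lemma box_volume_ge0 p : 0 <= box_volume p.
Proof. by apply: prodr_ge0 => i _; rewrite le_max lexx. Qed.

Local Open Scope ereal_scope.

(* Covers are countable sets of boxes, rather than sequences of boxes, so that
   the empty cover is available also for n = 0. *)
Definition box_cover A : set (set ('rV[R]_n * 'rV[R]_n)) :=
  [set C | countable C /\ A `<=` \bigcup_(p in C) box p].

Definition lebesgue_outer A : \bar R :=
  ereal_inf [set \esum_(p in C) (box_volume p)%:E | C in box_cover A].

Let esum_volume_ge0 C : 0 <= \esum_(p in C) (box_volume p)%:E.
Proof. by apply: esum_ge0 => p _; rewrite lee_fin box_volume_ge0. Qed.

Let lebesgue_outer_ge0 A : 0 <= lebesgue_outer A.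
Proof. by apply: le_ereal_inf_tmp => _ [C _ <-]. Qed.

Let lebesgue_outer0 : lebesgue_outer set0 = 0.
Proof.
apply/eqP; rewrite eq_le lebesgue_outer_ge0 andbT.
apply: ereal_inf_lbound; exists set0; last by rewrite esum_set0.
by split; [exact: countable0|exact: sub0set].
Qed.

Let le_lebesgue_outer : {homo lebesgue_outer : A B / A `<=` B >-> A <= B}.
Proof.
move=> A B AB; apply/ereal_inf_le_tmp => _ [C [cC BC] <-].
by exists C => //; split => //; exact: subset_trans BC.
Qed.

Let esum_bigcup_le (C : (set ('rV[R]_n * 'rV[R]_n))^nat) :
  \esum_(p in \bigcup_k C k) (box_volume p)%:E <=
  \sum_(k <oo) \esum_(p in C k) (box_volume p)%:E.
Proof.
rewrite seqDU_bigcup_eq esum_bigcupT; last 2 first.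
- exact: trivIset_seqDU.
- by move=> p; rewrite lee_fin box_volume_ge0.
rewrite -nneseries_esumT; last by move=> k; exact: esum_volume_ge0.
apply: lee_nneseries => [k _ _|k _]; first exact: esum_volume_ge0.
rewrite esum_mkcond [leRHS]esum_mkcond; apply: le_esum => p _.
case: ifPn => [/set_mem Dp|_].
  by rewrite ifT//; apply: mem_set; exact: subset_seqDU Dp.
by case: ifPn => // _; rewrite lee_fin box_volume_ge0.
Qed.

Let lebesgue_outer_sigma_subadditive : sigma_subadditive lebesgue_outer.
Proof.
move=> A; have [[i ioo]|] := pselect (exists i, lebesgue_outer (A i) = +oo).
  rewrite (eseries_pinfty _ _ ioo) ?leey// => k _.
  by rewrite -ltNye (lt_le_trans _ (lebesgue_outer_ge0 _)).
rewrite -forallNE => Aoo; apply/lee_addgt0Pr => e e0.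
rewrite (le_trans _ (epsilon_trick _ _ (ltW e0)))//.
have /choice[C PC] : forall k, exists C, box_cover (A k) C /\
    \esum_(p in C) (box_volume p)%:E <=
    lebesgue_outer (A k) + (e / (2 ^ k.+1)%:R)%:E.
  move=> k; have ek : (0 < e / (2 ^ k.+1)%:R)%R.
    by rewrite divr_gt0// ltr0n expn_gt0.
  have fk : lebesgue_outer (A k) \is a fin_num.
    by rewrite ge0_fin_numE// ltey; exact/eqP.
  have [_ [C AC <-] /ltW leC] := lb_ereal_inf_adherent ek fk.
  by exists C.
apply: (@le_trans _ _ (\sum_(k <oo) \esum_(p in C k) (box_volume p)%:E)).
  apply: le_trans (esum_bigcup_le C); apply: ereal_inf_lbound.
  exists (\bigcup_k C k) => //; split.
    by apply: bigcup_countable => // k _; have [[]] := PC k.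
  move=> x [k _ Akx]; have [[_ /(_ x Akx)[p Cp px]] _] := PC k.
  by exists p => //; exists k.
by apply: lee_nneseries => [k _ _|k _]; [exact: esum_volume_ge0|exact: (PC k).2].
Qed.

HB.instance Definition _ := isOuterMeasure.Build R 'rV[R]_n lebesgue_outer
  lebesgue_outer0 lebesgue_outer_ge0 le_lebesgue_outer
  lebesgue_outer_sigma_subadditive.

End lebesgue_outer_measure.

(* Lebesgue-measurable sets are the Caratheodory-measurable ones, and Hn n is
   n-dimensional Lebesgue measure, i.e. n-dimensional Hausdorff measure with
   the normalization that gives the unit cube measure 1. *)
Definition Rn (R : realType) (n : nat) : measurableType _ :=
  caratheodory_type (@lebesgue_outer R n).

Definition Hn {R : realType} {n : nat} : set (Rn R n) -> \bar R :=
  @lebesgue_outer R n.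

HB.instance Definition _ (R : realType) (n : nat) := isMeasure.Build _ _ _
  (@Hn R n) (@caratheodory_measure0 _ _ (@lebesgue_outer R n))
  (@caratheodory_measure_ge0 _ _ (@lebesgue_outer R n))
  (@caratheodory_measure_sigma_additive _ _ (@lebesgue_outer R n)).

Section function_classes.
Context {R : realType} {n : nat}.
Implicit Types (f g : Rn R n -> R) (X : set (Rn R n -> R))
  (T : (Rn R n -> R) -> (Rn R n -> R)).

Definition essinf f : \bar R := ess_inf Hn (EFin \o f).

Definition ess_le f g : Prop := {ae Hn, forall x, f x <= g x}.

Definition Mclass : set (Rn R n -> R) := [set f | measurable_fun setT f].

Definition Sclass : set (Rn R n -> R) :=
  [set f | Mclass f /\ forall t : R, (essinf f < t%:E)%E ->
    (Hn [set x | (t < f x)%R] < +oo)%E].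

(* Functions are only considered up to null sets, so "nonnegative" means
   essentially nonnegative. An everywhere pointwise condition would not be
   preserved: an equimeasurable T may alter its values on a null set. *)
Definition Vclass : set (Rn R n -> R) :=
  [set f | [/\ Mclass f, ess_le (cst 0) f &
    forall t : R, 0 < t -> (Hn [set x | (t < f x)%R] < +oo)%E]].

(* A map T : X -> X is a map T on all functions such that set_fun X X T; the
   conditions below only involve its values on X. *)
Definition equimeasurable X T : Prop := forall f, X f -> forall t : R,
  Hn [set x | t < T f x] = Hn [set x | t < f x].

Definition monotonic X T : Prop := forall f g, X f -> X g ->
  ess_le f g -> ess_le (T f) (T g).

Definition rearrangement X T : Prop := equimeasurable X T /\ monotonic X T.

End function_classes.

Arguments Mclass : clear implicits.
Arguments Sclass : clear implicits.
Arguments Vclass : clear implicits.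

(* Main.v *)
Require Import Defs.
From mathcomp Require Import all_boot all_order all_algebra.
From mathcomp Require Import all_classical all_reals all_analysis.
From mathcomp Require Import ess_sup_inf measurable_realfun.

(** Everything except the lower bound for rearrangements is read off from the
distribution function t |-> Hn {f > t}.

For equimeasurable T on the class S, let f and g in S have the same
distribution function and let t < essinf f, so that {f > t} has full measure.
If essinf g < t held, then {g > t} would have finite measure, and this measure
would be that of {f > t}, hence that of the whole space; a subset of the same
finite measure is of full measure, so g > t a.e., contradicting essinf g < t.
Thus essinf f <= essinf g ([le_essinf_equidistributed]), and by symmetry the
essential infima agree.

For a rearrangement T on all measurable functions, monotonicity reduces the
inequality essinf f <= essinf (T f) to constants: if f >= t a.e. then
T f >= T t a.e., so it suffices that T c >= c a.e. for each constant c.  The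
distribution function of T c cannot give this, because a set of infinite
measure may omit a set of positive measure.  Instead, take a measurable f <= c
all of whose superlevel sets have finite measure, for instance c minus the
l^1-norm.  For t <= a < c, raise f to c on {f > t} to get g.  Then
f <= g <= c, and the three sets {f > t}, {g > t} and {g > a} coincide, so the
sets {T f > t}, {T g > t} and {T g > a} have the same finite measure.  As
{T g > a} lies in {T g > t}, the two agree up to a null set, and almost
everywhere
  T f > t  ==>  T g > t  ==>  T g > a  ==>  T c > a
([rearrangement_cst_gt]).  Now let t decrease to -oo and a increase to c: as
T f is real-valued, every point satisfies T f > t for t low enough, and so
T c >= c almost everywhere ([rearrangement_cst_ge]).

Such an f must be measurable, which here means with respect to the
Caratheodory sigma-algebra of the outer measure built from boxes.  Coordinates
are measurable because a half-space {x_i <= a} cuts every box into two boxes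
whose volumes add up, and therefore splits every cover by boxes without
changing its total volume ([caratheodory_halfspace]).

The last part follows from essinf f <= essinf (T f) on S, which holds in both
cases: the nonnegative class V is contained in S, and for a constant c the
inequality gives T c >= c, while Hn {T c > c} = Hn {c > c} = 0. *)

Set Implicit Arguments.
Unset Strict Implicit.
Unset Printing Implicit Defensive.

Import Order.TTheory GRing.Theory Num.Theory.

Local Open Scope classical_set_scope.
Local Open Scope ring_scope.

(** * Half-spaces, coordinates and boxes *)

(** Terms of the right-hand sum that e identifies are counted once on the left.
Choosing one preimage for each point of the image makes e injective on a
subset of A with the same image, where the two sums agree. *)
Lemma esum_image_le (R : realType) (I J : choiceType) (A : set I) (e : I -> J)
    (a : J -> \bar R) : (forall j, (0 <= a j)%E) ->
  (\esum_(j in e @` A) a j <= \esum_(i in A) a (e i))%E.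
Proof.
move=> a0; have [[i0 Ai0]|A0] := pselect (exists i, A i); last first.
  have -> : A = set0 by rewrite -subset0 => i Ai; apply: A0; exists i.
  by rewrite image_set0 !esum_set0.
(* s picks a preimage in A of each point of the image; i0 is only the default
   value of the choice operator. *)
pose s j := xget i0 [set i | A i /\ e i = j].
have sP i : A i -> A (s (e i)) /\ e (s (e i)) = e i.
  by move=> Ai; apply: (@xgetPex _ i0 [set k | A k /\ e k = e i]); exists i.
pose B := s @` (e @` A).
have BA : B `<=` A by move=> _ [_ [i Ai <-] <-]; exact: (sP i Ai).1.
have -> : e @` A = e @` B.
  apply/seteqP; split=> [_ [i Ai <-]|]; last exact: image_subset.
  by exists (s (e i)); [exists (e i) => //; exists i|exact: (sP i Ai).2].
rewrite esum_image; last first.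
  move=> _ _ /set_mem[_ [i Ai <-] <-] /set_mem[_ [j Aj <-] <-].
  by rewrite (sP i Ai).2 (sP j Aj).2 => ->.
rewrite esum_mkcond [leRHS]esum_mkcond; apply: le_esum => i _.
by case: ifPn => [/set_mem/BA/mem_set ->//|_]; case: ifP.
Qed.

Section halfspaces.
Context {R : realType} {n : nat}.
Implicit Types (p : 'rV[R]_n * 'rV[R]_n) (i : 'I_n) (a : R).

Lemma cut_length (l u a : R) :
  Num.max 0 (Num.min u a - l) + Num.max 0 (u - Num.max l a) = Num.max 0 (u - l).
Proof.
have [ua|au] := leP u a; have [la|al] := leP l a.
- by rewrite [X in _ + X]max_l ?addr0// subr_le0.
- by rewrite !max_l ?addr0// subr_le0 (le_trans ua)// ltW.
- rewrite !max_r ?subr_ge0// ?(le_trans la) ?(ltW au)//.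
  by rewrite addrC addrA subrK.
- by rewrite max_l ?add0r// subr_le0 ltW.
Qed.

Definition cut_below i a p : 'rV[R]_n * 'rV[R]_n :=
  (p.1, \row_j if j == i then Num.min (p.2 0 j) a else p.2 0 j).

Definition cut_above i a p : 'rV[R]_n * 'rV[R]_n :=
  (\row_j if j == i then Num.max (p.1 0 j) a else p.1 0 j, p.2).

Lemma box_cut_below i a p :
  box p `&` [set x | x 0 i <= a] `<=` box (cut_below i a p).
Proof.
move=> x [px /= xa] j; have := px j; rewrite !in_itv/= !mxE => /andP[-> xj].
by case: ifP => // /eqP ji; rewrite le_min xj ji.
Qed.

Lemma box_cut_above i a p :
  box p `\` [set x | x 0 i <= a] `<=` box (cut_above i a p).
Proof.
move=> x [px /= /negP xa] j; have := px j.
rewrite !in_itv/= !mxE => /andP[xj ->]; rewrite andbT.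
by case: ifP => // /eqP ji; rewrite gt_max xj ji ltNge.
Qed.

Lemma box_volume_cut i a p :
  box_volume (cut_below i a p) + box_volume (cut_above i a p) = box_volume p.
Proof.
have volE q : box_volume q = Num.max 0 (q.2 0 i - q.1 0 i) *
    \prod_(j < n | j != i) Num.max 0 (q.2 0 j - q.1 0 j) by exact: bigD1.
rewrite !volE/= !mxE !eqxx.
under eq_bigr => j /negPf ji do rewrite mxE ji.
under [X in _ + _ * X]eq_bigr => j /negPf ji do rewrite mxE ji.
rewrite -mulrDl; congr *%R.
exact: cut_length.
Qed.

(** Covers being sets of boxes, a cover obtained by transforming the boxes of
another one may merge some of them, which only decreases the total volume. *)
Lemma lebesgue_outer_le_cover (A : set 'rV[R]_n)
    (C : set ('rV[R]_n * 'rV[R]_n)) (e : _ -> 'rV[R]_n * 'rV[R]_n) :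
  countable C -> A `<=` \bigcup_(p in C) box (e p) ->
  (lebesgue_outer A <= \esum_(p in C) (box_volume (e p))%:E)%E.
Proof.
move=> cC AC; apply: (@le_trans _ _
    (\esum_(q in e @` C) (box_volume q)%:E)%E).
  apply: ereal_inf_lbound; exists (e @` C) => //; split.
    exact: card_le_trans (card_image_le e C) cC.
  by apply: subset_trans AC _ => x [p Cp px]; exists (e p) => //; exists p.
by apply: esum_image_le => q; rewrite lee_fin box_volume_ge0.
Qed.

(** Cutting each box of a cover of A along the hyperplane x_i = a yields covers
of the two parts of A with the same total volume as the original cover. *)
Lemma caratheodory_halfspace i a :
  (@lebesgue_outer R n).-caratheodory [set x | x 0 i <= a].
Proof.
apply: le_caratheodory_measurable => A; apply: le_ereal_inf_tmp.
move=> _ [C [cC AC] <-].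
have -> : (\esum_(p in C) (box_volume p)%:E =
    \esum_(p in C) (box_volume (cut_below i a p))%:E +
    \esum_(p in C) (box_volume (cut_above i a p))%:E)%E.
  rewrite -esumD; last 2 first.
  - by move=> p _; rewrite lee_fin box_volume_ge0.
  - by move=> p _; rewrite lee_fin box_volume_ge0.
  by apply: eq_esum => p _; rewrite -EFinD box_volume_cut.
apply: leeD; apply: lebesgue_outer_le_cover => // x [/AC[p Cp px] xa].
- by exists p => //; exact: box_cut_below.
- by exists p => //; exact: box_cut_above.
Qed.

Lemma measurable_coordinate i :
  measurable_fun setT (fun x : Rn R n => (x : 'rV[R]_n) 0 i).
Proof.
apply: (measurability _ (RGenOInfty.measurableE R)) => _ [_ [a ->] <-].
rewrite setTI (_ : _ @^-1` _ = ~` [set x : Rn R n | (x : 'rV[R]_n) 0 i <= a]).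
  by apply: measurableC; exact: caratheodory_halfspace.
by apply/seteqP; split=> x /=; rewrite in_itv/= andbT ltNge => /negP.
Qed.

Lemma Hn_box_lty p : (Hn (box p) < +oo)%E.
Proof.
apply: (@le_lt_trans _ _ (box_volume p)%:E); last exact: ltry.
rewrite -(@esum_set1 _ _ p (fun q => (box_volume q)%:E)); last first.
  by rewrite lee_fin box_volume_ge0.
apply: (@lebesgue_outer_le_cover _ _ id); first exact: countable1.
by move=> x px; exists p.
Qed.

(** The opposite of the l^1-norm: it decreases to -oo at infinity, so each of
its superlevel sets is contained in a cube. *)
Lemma exists_finite_superlevels :
  exists2 f : Rn R n -> R, Mclass R n f &
    (forall x, f x <= 0) /\ forall t : R, (Hn [set x | (t < f x)%R] < +oo)%E.
Proof.
exists (fun x : Rn R n => - \sum_(i < n) `|(x : 'rV[R]_n) 0 i|).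
  apply: measurableT_comp => //; apply: measurable_sum => i.
  apply: measurableT_comp; last exact: measurable_coordinate.
  exact: normr_measurable.
split=> [x|t]; first by rewrite oppr_le0 sumr_ge0.
apply: le_lt_trans (Hn_box_lty (const_mx t, const_mx (- t))).
apply: le_outer_measure => x /=; rewrite ltrNr => xt i.
rewrite in_itv/= !mxE.
have : `|x 0 i| < - t.
  apply: le_lt_trans xt; rewrite (bigD1 i)//= lerDl; exact: sumr_ge0.
by rewrite ltr_norml opprK => /andP[-> /ltW].
Qed.
End halfspaces.

(** * Comparing sets up to null sets *)

Section measure_comparison.
Context d (T : measurableType d) (R : realType).
Variable mu : {measure set T -> \bar R}.

Lemma ae_eq_measureT (A : set T) : measurable A ->
  {ae mu, forall x, A x} -> mu A = mu setT.
Proof.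
move=> mA aeA; rewrite (measureDI mu measurableT mA) setTI setTD.
have /negligibleP -> := aeA; first by rewrite add0e.
exact: measurableC.
Qed.

Lemma ae_sub_of_eq_measure (A B : set T) : measurable A -> measurable B ->
    B `<=` A -> (mu B < +oo)%E -> mu A = mu B ->
  {ae mu, forall x, A x -> B x}.
Proof.
move=> mA mB BA Boo AB; exists (A `\` B); split.
- exact: measurableD.
- have Aoo : (mu A < +oo)%E by rewrite AB.
  rewrite measureD// (setIidr BA) [X in (X - _)%E]AB subee//.
  by rewrite ge0_fin_numE.
- by move=> x /not_implyP.
Qed.
End measure_comparison.

(** * Essential infima and distribution functions *)

Section rearrangements.
Context {R : realType} {n : nat}.
Implicit Types (f g : Rn R n -> R) (T : (Rn R n -> R) -> (Rn R n -> R)).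

Lemma measurable_superlevel f t : Mclass R n f -> measurable [set x | t < f x].
Proof.
move=> mf; rewrite (_ : [set x | _] = setT `&` f @^-1` `]t, +oo[).
  by apply: mf => //; exact: measurable_itv.
by rewrite setTI; apply/seteqP; split=> x /=; rewrite in_itv/= andbT.
Qed.

Lemma essinf_geP f t : {ae Hn, forall x, t <= f x} <-> (t%:E <= essinf f)%E.
Proof.
split=> [tf|/ess_infP].
  by apply/ess_infP; apply: filterS tf => x; rewrite lee_fin.
by apply: filterS => x; rewrite lee_fin.
Qed.

Lemma lee_of_reals_below (x y : \bar R) :
  (forall t : R, (t%:E < x)%E -> (t%:E <= y)%E) -> (x <= y)%E.
Proof.
case: x y => [x| |] [y| |]// xy; rewrite ?leey ?leNye//.
- rewrite lee_fin; apply/ler_addgt0Pr => e e0; rewrite -lerBlDr -lee_fin.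
  by apply: xy; rewrite lte_fin ltrBlDr ltrDl.
- have := xy (x - 1); rewrite lte_fin ltrBlDr ltrDl ltr01 leeNy_eq.
  by move=> /(_ isT).
- have := xy (y + 1); rewrite ltry lee_fin => /(_ isT).
  by rewrite gerDl ler10.
- by have := xy 0; rewrite ltry leeNy_eq => /(_ isT).
Qed.

(** Finiteness of Hn {g > t} above essinf g is what makes the distribution
function determine the essential infimum: if essinf g < t < essinf f, then
{g > t} has the measure of the whole space, which is thereby finite, so that
{g > t} is of full measure. *)
Lemma le_essinf_equidistributed f g : Sclass R n f -> Sclass R n g ->
    (forall t, Hn [set x | t < g x] = Hn [set x | t < f x]) ->
  (essinf f <= essinf g)%E.
Proof.
move=> [mf _] [mg Sg] gf; apply: lee_of_reals_below => t tf.
rewrite leNgt; apply/negP => gt.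
have fT : Hn [set x | t < f x] = Hn [set: Rn R n].
  apply: ae_eq_measureT; first exact: measurable_superlevel.
  apply: filterS (ess_inf_le Hn (EFin \o f)) => x /(lt_le_trans tf).
  by rewrite lte_fin.
(* {g > t} now has the finite measure of the whole space, so g > t a.e. *)
have := gt; rewrite ltNge => /negP; apply; apply/essinf_geP.
have : {ae Hn, forall x : Rn R n, setT x -> t < g x}.
  apply: (@ae_sub_of_eq_measure _ _ _ _ setT [set x | t < g x]) => //.
  - exact: measurable_superlevel.
  - exact: Sg.
  - exact: etrans (esym fT) (esym (gf t)).
by apply: filterS => x /(_ I)/ltW.
Qed.

Lemma equimeasurable_le_cst X T c : X (cst c) -> Mclass R n (T (cst c)) ->
  equimeasurable X T -> {ae Hn, forall x, T (cst c) x <= c}.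
Proof.
move=> Xc mTc eqT; exists [set x | c < T (cst c) x]; split.
- exact: measurable_superlevel.
- rewrite eqT// (_ : [set x | _] = set0) ?measure0//.
  by rewrite -subset0 => x /=; rewrite ltxx.
- by move=> x /=/negP; rewrite -ltNge.
Qed.

Lemma Sclass_cst c : Sclass R n (cst c).
Proof.
split=> [|t ct]; first exact: measurable_cst.
have {}ct : c < t.
  rewrite -lte_fin; apply: le_lt_trans ct; apply/essinf_geP.
  exact: aeW.
rewrite (_ : [set x | _] = set0) ?measure0//.
by rewrite -subset0 => x /= /(lt_trans ct); rewrite ltxx.
Qed.

Lemma Vclass_Sclass : Vclass R n `<=` Sclass R n.
Proof.
move=> f [mf f0 Vf]; split=> // t ft; apply: Vf.
by rewrite -lte_fin; apply: le_lt_trans ft; exact/essinf_geP.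
Qed.

(** * Rearrangements of measurable functions *)

(** Raising f to the constant c on {f > t} keeps it below c, and creates a gap:
the resulting g has no values in ]t, c[.  By equimeasurability T g has
almost no values there either, so where T f > t, the larger T g must exceed
every a < c, and T c dominates T g. *)
Lemma rearrangement_cst_gt T f (t a c : R) :
    set_fun (Mclass R n) (Mclass R n) T -> rearrangement (Mclass R n) T ->
    Mclass R n f -> (forall x, f x <= c) ->
    (Hn [set x | (t < f x)%R] < +oo)%E -> t <= a -> a < c ->
  {ae Hn, forall x, t < T f x -> a < T (cst c) x}.
Proof.
move=> TM [eqT monoT] mf fc foo ta ac.
pose g x := if t < f x then c else f x.
have mg : Mclass R n g.
  by apply: measurable_fun_ifT => //; exact: measurable_fun_ltr.
have mc : Mclass R n (cst c) by exact: measurable_cst.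
have fg : ess_le f g by apply: aeW => x; rewrite /g; case: ifP.
have gc : ess_le g (cst c) by apply: aeW => x; rewrite /g; case: ifP.
have glevel s : t <= s -> s < c -> [set x | s < g x] = [set x | t < f x].
  move=> ts sc; apply/seteqP; split=> x /=; rewrite /g; case: ifPn => //.
  by rewrite -leNgt => ft /(le_lt_trans ts)/(le_lt_trans ft); rewrite ltxx.
have Tglevel s : t <= s -> s < c ->
    Hn [set x | s < T g x] = Hn [set x | t < f x].
  by move=> ts sc; rewrite eqT// glevel.
(* The superlevel sets of T g at t and a are nested and have the same finite
   measure. *)
have : {ae Hn, forall x, t < T g x -> a < T g x}.
  apply: (@ae_sub_of_eq_measure _ _ _ _ [set x | t < T g x]
    [set x | a < T g x]).
  - exact/measurable_superlevel/TM.
  - exact/measurable_superlevel/TM.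
  - by move=> x /=; exact: le_lt_trans.
  - by apply: le_lt_trans foo; rewrite -(Tglevel a).
  - apply: etrans (esym (Tglevel a ta ac)); apply: Tglevel => //.
    exact: le_lt_trans ac.
have := monoT _ _ mg mc gc; have := monoT _ _ mf mg fg.
apply: filterS3 => x Tfg Tgc Tga tf.
exact/(lt_le_trans _ Tgc)/Tga/(lt_le_trans tf).
Qed.

(** Apply [rearrangement_cst_gt] with the levels t = c - (k + 1) and
a = c - 1 / (k + 1) for all k at once.  At a given point T f > t holds as soon
as k is large, because T f is real-valued there. *)
Lemma rearrangement_cst_ge T c :
    set_fun (Mclass R n) (Mclass R n) T -> rearrangement (Mclass R n) T ->
  {ae Hn, forall x, c <= T (cst c) x}.
Proof.
move=> TM reT; have [f0 mf0 [f0le f0oo]] := @exists_finite_superlevels R n.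
pose f x := c + f0 x.
have mf : Mclass R n f by apply: measurable_funD => //; exact: measurable_cst.
have : {ae Hn, forall x, forall k : nat, c - k.+1%:R < T f x ->
    c - k.+1%:R^-1 < T (cst c) x}.
  apply: ae_foralln => k; apply: rearrangement_cst_gt => //.
  - by move=> x; rewrite gerDl.
  - rewrite (_ : [set x | _] = [set x | - k.+1%:R < f0 x]) ?f0oo//.
    by apply/seteqP; split=> x /=; rewrite /f ltrD2l.
  - by rewrite lerD2l lerN2 (@le_trans _ _ 1)// ?invf_le1 ?ler1n// ltr0n.
  - by rewrite ltrBlDr ltrDl invr_gt0 ltr0n.
apply: filterS => x Tx; apply/ler_addgt0Pr => e e0.
pose k := maxn (Num.truncn (c - T f x)) (Num.truncn e^-1).
have fk : c - T f x < k.+1%:R.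
  by rewrite -truncn_le_nat leq_maxl.
have ek : e^-1 < k.+1%:R.
  by rewrite -truncn_le_nat leq_maxr.
rewrite -lerBlDr ltW//; apply: le_lt_trans (Tx k _).
  by rewrite lerD2l lerN2 invf_ple ?posrE ?ltr0n// ltW.
by rewrite ltrBlDr -ltrBlDl.
Qed.

Lemma rearrangement_essinf T f :
    set_fun (Mclass R n) (Mclass R n) T -> rearrangement (Mclass R n) T ->
  Mclass R n f -> (essinf f <= essinf (T f))%E.
Proof.
move=> TM reT mf; apply: lee_of_reals_below => t /ltW/essinf_geP tf.
apply/essinf_geP; have mt : Mclass R n (cst t) by exact: measurable_cst.
have := reT.2 _ _ mt mf tf; have := rearrangement_cst_ge t TM reT.
by apply: filterS2 => x; exact: le_trans.
Qed.

End rearrangements.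

Theorem lemma4p1 (R : realType) (n : nat) (n_ge2 : (2 <= n)%N) :
  [/\ forall T : (Rn R n -> R) -> (Rn R n -> R),
        set_fun (Sclass R n) (Sclass R n) T ->
        equimeasurable (Sclass R n) T ->
        forall f, Sclass R n f -> essinf (T f) = essinf f,

      forall T : (Rn R n -> R) -> (Rn R n -> R),
        set_fun (Mclass R n) (Mclass R n) T ->
        rearrangement (Mclass R n) T ->
        (forall f, Mclass R n f -> (essinf f <= essinf (T f))%E) /\
        set_fun (Sclass R n) (Sclass R n) T &

      forall T : (Rn R n -> R) -> (Rn R n -> R),
        set_fun (Sclass R n) (Sclass R n) T /\
          equimeasurable (Sclass R n) T \/
        set_fun (Mclass R n) (Mclass R n) T /\
          rearrangement (Mclass R n) T ->
        set_fun (Vclass R n) (Vclass R n) T /\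
        forall c : R, {ae Hn, forall x : Rn R n, T (cst c) x = c}].
Proof.
have essinf_S (T : (Rn R n -> R) -> (Rn R n -> R)) :
    set_fun (Sclass R n) (Sclass R n) T -> equimeasurable (Sclass R n) T ->
    forall f, Sclass R n f -> essinf (T f) = essinf f.
  move=> TS eqT f Sf; apply/eqP; rewrite eq_le.
  by rewrite !le_essinf_equidistributed//; [exact: TS|exact: eqT|exact: TS|
    move=> t; rewrite eqT].
have S_of_rearrangement (T : (Rn R n -> R) -> (Rn R n -> R)) :
    set_fun (Mclass R n) (Mclass R n) T -> rearrangement (Mclass R n) T ->
    set_fun (Sclass R n) (Sclass R n) T.
  move=> TM reT f [mf Sf]; split=> [|t Tft]; first exact: TM.
  rewrite reT.1//; apply: Sf; apply: le_lt_trans Tft.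
  exact: rearrangement_essinf.
split=> // [T TM reT|T hT].
  by split=> [f mf|]; [exact: rearrangement_essinf|exact: S_of_rearrangement].
have [TS eqT geT] : [/\ set_fun (Sclass R n) (Sclass R n) T,
    equimeasurable (Sclass R n) T &
    forall f, Sclass R n f -> (essinf f <= essinf (T f))%E].
  case: hT => [[TS eqT]|[TM reT]].
    by split=> // f Sf; rewrite essinf_S.
  split; [exact: S_of_rearrangement|by move=> f [mf _]; exact: reT.1|].
  by move=> f [mf _]; exact: rearrangement_essinf.
split=> [f Vf|c].
  have Sf := Vclass_Sclass Vf; case: Vf => _ f0 Vf; split.
  - by have [] := TS _ Sf.
  - by apply/essinf_geP; apply: le_trans (geT _ Sf); exact/essinf_geP.
  - by move=> t t0; rewrite eqT//; exact: Vf.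
have Sc := @Sclass_cst R n c.
have Tc_ge : {ae Hn, forall x : Rn R n, c <= T (cst c) x}.
  by apply/essinf_geP; apply: le_trans (geT _ Sc); apply/essinf_geP; exact: aeW.
have := equimeasurable_le_cst Sc (TS _ Sc).1 eqT; move: Tc_ge.
by apply: filterS2 => x cT Tc; apply/eqP; rewrite eq_le cT Tc.
Qed.
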